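(* For every odd integer $m>1$ there exists a cyclic $(4m+1,m,2,1)$-CEDF with step-count $3$.
   Context: For subsets $A,B$ of an additive group $G$, $\Delta(A,B)$ denotes the multiset $\{a-b\mid a\in A,\ b\in B\}$. Let $G$ be an additive group of order $v$. A sequence $(A_0,\dots,A_{m-1})$ of $m\ge 2$ pairwise disjoint $\ell$-subsets of $G$ is a $(v,m,\ell,\lambda)$-CEDF (circular external difference family) over $G$ if the multiset union $\bigcup_{i\in\mathbb{Z}_m}\Delta(A_{i+1},A_i)$ (indices modulo $m$) equals $\lambda(G\setminus\{0\})$, i.e. contains each nonzero element of $G$ exactly $\lambda$ times and does not contain $0$. The CEDF is called cyclic if $G=\mathbb{Z}_v$. When $\ell=2$, each $A_i$ can be written as $\{x_i,x_i+d_i\}$ with $d_i\neq 0$, and its step is $\delta(A_i)=\{d_i,-d_i\}$ (which depends only on $A_i$); the step-count of the CEDF is the number of distinct sets among $\delta(A_0),\dots,\delta(A_{m-1})$. *)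

(* Defs.v *)
From mathcomp Require Import all_boot all_order all_algebra.
From mathcomp Require Import finmap multiset.

Set Implicit Arguments.
Unset Strict Implicit.
Unset Printing Implicit Defensive.

Import GRing.Theory.
Local Open Scope mset_scope.
Local Open Scope ring_scope.

Definition Delta (G : finZmodType) (A B : {set G}) : {mset G} :=
  seq_mset [seq a - b | a <- enum A, b <- enum B].

(* For D : {mset G}, D g is the multiplicity of g in D; ordS is the successor
   modulo m on 'I_m. *)
Definition is_CEDF (G : finZmodType) (v m l lambda : nat)
    (A : 'I_m -> {set G}) : Prop :=
  [/\ #|G| = v,
      (1 < m)%N,
      forall i, #|A i| = l,
      forall i j, i != j -> [disjoint A i & A j] &
      forall g : G,
        (\big[@msetD G/mset0]_(i < m) Delta (A (ordS i)) (A i)) g =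
          if g == 0 then 0%N else lambda].

(* The step {d, -d} of A = {x, x + d} with d != 0, for an arbitrary choice of
   such a pair (x, d); stepE shows that the choice is irrelevant.  The default
   set0 is only reached when A does not have two elements. *)
Definition step (G : finZmodType) (A : {set G}) : {set G} :=
  if [pick p : G * G | (p.2 != 0) && (A == [set p.1; p.1 + p.2])] is Some p
  then [set p.2; - p.2] else set0.

Lemma stepE (G : finZmodType) (x d : G) :
  d != 0 -> step [set x; x + d] = [set d; - d].
Proof.
move=> d0; rewrite /step; case: pickP => [[y e] /= /andP[e0 /eqP eqA]|]; last first.
  by move=> /(_ (x, d)) /=; rewrite d0 eqxx.
have /set2P[yx|yx] : y \in [set x; x + d] by rewrite eqA set21.
- have /set2P[] : x + d \in [set y; y + e] by rewrite -eqA set22.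
    by rewrite yx => /eqP; rewrite -subr_eq0 addrAC subrr add0r (negPf d0).
  by rewrite yx => /addrI ->.
- have /set2P[] : x \in [set y; y + e] by rewrite -eqA set21.
    by rewrite yx => /eqP; rewrite eq_sym -subr_eq0 addrAC subrr add0r (negPf d0).
  rewrite yx -addrA -{1}[x]addr0 => /addrI /eqP.
  by rewrite eq_sym addrC addr_eq0 => /eqP ->; rewrite opprK setUC.
Qed.

Definition step_count (G : finZmodType) (m : nat) (A : 'I_m -> {set G}) : nat :=
  #|[set step (A i) | i : 'I_m]|.

(* Main.v *)
Require Import Defs.
From mathcomp Require Import all_boot all_order all_algebra.
From mathcomp Require Import finmap multiset zify.
Import GRing.Theory.

(** Write m = 2h + 3, so that v = 4m + 1 = 8h + 13, and let the sets, taken in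
    cyclic order, have steps 2, 5, 2, 5, .., 2, 5, 6.  Whatever the base points
    are, a set of step 2 and a neighbour of step 5 contribute a translate
    s + {0, 2, 5, 7}, called a tile below; the last set, of step 6, contributes
    a translate of {0, 5, 6, 11} with its predecessor and a translate of
    {0, 2, 6, 8} with its successor.

    The elements of a tile are distinct modulo 4, so tiles at distance 4 fit
    together: those starting at 1, 5, 9, .., 8h + 5, together with
    {-4, -2, 2, 4}, partition the nonzero residues modulo v.  The two
    consecutive tiles at 4h + 1 and 4h + 5 have the same union as the tile at
    4h + 3 and (4h + 1) + {0, 5, 6, 11}.  After this exchange there is one piece
    for each of the m pairs of cyclically consecutive sets, and every order in
    which the tiles are used gives the right differences.

    It remains to find an order for which the sets are pairwise disjoint.  As in
    the graceful labellings of paths, a zigzag is used, in which the sets of step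
    5 advance by 4 and the sets of step 2 recede by 4, so that the two families
    sweep complementary arcs of the circle.  The exceptional tile at 4h + 3 sits
    in the middle, where the parity of the tiles available for moving forward
    and backward changes.  In the plain zigzag only one clash occurs, between
    the last set {-2, 4} and the third one, {-4, -2}; exchanging the tiles of
    four edges, namely the first one, the last one between sets of steps 2 and 5,
    and two next to the middle, moves this clash away as soon as h >= 3, giving
    the base points [corner].  The cases h = 0, 1, 2 are explicit examples.

    Since the m * 4 differences are as many as the nonzero residues, it is
    enough to see that every nonzero residue is a difference
    ([CEDF_of_cover]); this is read off the tiles in [corner_cover], and
    disjointness is [corner_inj]. *)

(** * Counting differences *)

Lemma sum_count_mem (T : finType) (s : seq T) : \sum_x count_mem x s = size s.
Proof.
elim: s => [|y s IHs] /=; first by rewrite big1.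
rewrite big_split /= IHs (bigD1 y) //= eqxx big1 // => x.
by rewrite eq_sym => /negPf ->.
Qed.

Lemma msetD_bigE (T : choiceType) (I : Type) (r : seq I)
    (F : I -> {mset T}%mset) x :
  (\big[@msetD T/mset0%mset]_(i <- r) F i)%mset x = \sum_(i <- r) F i x.
Proof.
apply: (big_morph (fun D : {mset T}%mset => D x)) => [D E|].
  by rewrite msetE2.
by rewrite mset0E.
Qed.

Lemma ordS_neq {m} (m_gt1 : 1 < m) (i : 'I_m) : ordS i != i.
Proof.
apply/eqP => /(congr1 val) /=; have := ltn_ord i; rewrite leq_eqVlt.
case/predU1P => [e|lt_i]; last by rewrite modn_small //; lia.
by rewrite -[X in _ %% X]e modnn; lia.
Qed.

(** The differences number m * l ^ 2 with multiplicity and avoid 0, so if they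
    reach all m * l ^ 2 nonzero elements, they reach each of them once. *)
Lemma CEDF_of_cover (G : finZmodType) (m l : nat) (A : 'I_m -> {set G}) :
    1 < m -> #|G| = m * l ^ 2 + 1 -> (forall i, #|A i| = l) ->
    (forall i j, i != j -> [disjoint A i & A j]) ->
    (forall g, g != 0%R ->
       exists i, exists2 a, a \in A (ordS i) &
         exists2 b, b \in A i & g = (a - b)%R) ->
  is_CEDF #|G| l 1 A.
Proof.
move=> m_gt1 cardG cardA disjA coverA; split=> //.
pose D i := [seq (a - b)%R | a <- enum (A (ordS i)), b <- enum (A i)].
pose mult g := \sum_i count_mem g (D i).
suff multE g : mult g = (g != 0%R).
  move=> g; rewrite msetD_bigE; under eq_bigr do rewrite mset_seqE.
  by rewrite -/(mult g) multE; case: eqP.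
have mult0 : mult 0%R = 0.
  apply: big1 => i _; apply/count_memPn/negP => /allpairsP[[a b] /= []].
  rewrite !mem_enum => Aa Ab /esym/eqP; rewrite subr_eq0 => /eqP eq_ab.
  have /pred0P/(_ a) := disjA _ _ (ordS_neq m_gt1 i).
  by rewrite /= Aa eq_ab Ab.
have mult_ge x : (x != 0%R) <= mult x ?= iff ((x != 0%R) == mult x :> nat).
  split=> //; case: (eqVneq x 0%R) => //= /coverA[i [a Aa [b Ab ->]]].
  rewrite /mult (bigD1 i) //= addn_gt0 -has_count; apply/orP; left.
  apply/hasP; exists (a - b)%R; last exact: eqxx.
  by apply/allpairsP; exists (a, b); rewrite !mem_enum.
have sum_mult : \sum_g mult g = m * l ^ 2.
  rewrite exchange_big /= -[m in RHS]card_ord -sum_nat_const.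
  by apply: eq_bigr => i _; rewrite sum_count_mem size_allpairs -!cardE !cardA
    mulnn.
have sum_nz : \sum_(g : G) (g != 0%R) = m * l ^ 2.
  have := cardC1 (0%R : G); rewrite cardG addn1 /= => <-.
  by rewrite -big_mkcond /= sum1_card.
have [_] := leqif_sum (fun g (_ : xpredT g) => mult_ge g).
rewrite sum_mult sum_nz eqxx => /esym/forallP/(_ g) /eqP.
by move=> <-.
Qed.

(** * From base points to sets of residues *)

(** The steps 2, 5, .., 2, 5, 6 around the cycle; m is meant to be odd. *)
Definition width m n := if n == m.-1 then 6 else if odd n then 5 else 2.

Definition pts m (w : nat -> nat) n := [:: w n; w n + width m n].

Definition is_diff m w r := exists n a b : nat, [/\ n < m,
  a \in pts m w (n.+1 %% m), b \in pts m w n & a = b + r %[mod 4 * m + 1]].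

Definition pts_inj m w := forall i j p q, i < m -> j < m ->
  p \in pts m w i -> q \in pts m w j -> p = q %[mod 4 * m + 1] -> i = j /\ p = q.

Definition sets m (w : nat -> nat) (i : 'I_m) : {set 'Z_(4 * m + 1)} :=
  [set (w i)%:R; (w i)%:R + (width m i)%:R]%R.

Lemma natr_Zp_eq v p q : 1 < v ->
  (p%:R == q%:R :> 'Z_v)%R = (p == q %[mod v]).
Proof. by move=> v_gt1; rewrite -val_eqE /= !val_Zp_nat. Qed.

Lemma mem_sets m w (i : 'I_m) p : p \in pts m w i -> (p%:R)%R \in sets m w i.
Proof. by rewrite !inE => /orP[] /eqP ->; rewrite ?natrD eqxx ?orbT. Qed.

Lemma mem_setsP m w (i : 'I_m) a : a \in sets m w i ->
  exists2 p, p \in pts m w i & a = (p%:R)%R.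
Proof.
by case/set2P=> ->; [exists (w i) | exists (w i + width m i)];
  rewrite ?inE ?eqxx ?orbT ?natrD.
Qed.

Lemma width_bounds m n : 2 <= width m n <= 6.
Proof. by rewrite /width; do 2?case: ifP. Qed.

Lemma CEDF_of_pts m w : 1 < m -> pts_inj m w ->
    (forall r, 0 < r -> r < 4 * m + 1 -> is_diff m w r) ->
  is_CEDF (4 * m + 1) 2 1 (sets m w).
Proof.
move=> m_gt1 w_inj w_cover.
have v_gt1 : 1 < 4 * m + 1 by lia.
have cardZ : #|'Z_(4 * m + 1)| = 4 * m + 1 by rewrite card_ord Zp_cast.
rewrite -[X in is_CEDF X]cardZ; apply: CEDF_of_cover => //.
- by rewrite cardZ; lia.
- move=> i; rewrite cards2 -natrD natr_Zp_eq //.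
  case: eqP => // eq_mod; exfalso.
  have [||_] := w_inj i i _ _ (ltn_ord i) (ltn_ord i) _ _ eq_mod.
  + by rewrite !inE eqxx.
  + by rewrite !inE eqxx orbT.
  + by have := width_bounds m i; lia.
- move=> i j i_neq_j; apply/pred0P => a /=; apply/negbTE/negP => /andP[].
  move=> /mem_setsP[p p_i ->] /mem_setsP[q q_j] /eqP.
  rewrite natr_Zp_eq // => /eqP.
  move=> /(w_inj _ _ _ _ (ltn_ord i) (ltn_ord j) p_i q_j)[/val_inj i_eq_j _].
  by rewrite i_eq_j eqxx in i_neq_j.
- move=> g g_neq0; have g_lt := ltn_ord g; rewrite [X in _ < X]Zp_cast // in g_lt.
  have [|n [a [b [n_lt a_n b_n ab]]]] := w_cover g _ g_lt.
    by rewrite lt0n; apply: contra g_neq0 => /eqP g0; apply/eqP/val_inj.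
  exists (Ordinal n_lt), (a%:R)%R; first exact: mem_sets.
  exists (b%:R)%R; first exact: mem_sets.
  apply/eqP; rewrite eq_sym subr_eq -{1}[g]natr_Zp -natrD natr_Zp_eq //.
  by rewrite [X in _ == X %[mod _]]addnC; apply/eqP.
Qed.

Lemma step_count_sets m w : odd m -> 1 < m -> step_count (sets m w) = 3.
Proof.
move=> m_odd m_gt1.
have v_gt1 : 1 < 4 * m + 1 by lia.
pose pm k : {set 'Z_(4 * m + 1)} := [set k%:R; - k%:R]%R.
have nz k : 0 < k < 13 -> (k%:R != 0 :> 'Z_(4 * m + 1))%R.
  move=> k_lt; rewrite -[0%R]/(0%:R)%R natr_Zp_eq // modn_small ?mod0n; lia.
(* k + k' < 13 <= 4 * m + 1, so k and - k' are different residues. *)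
have pm_inj k k' : 2 <= k <= 6 -> 2 <= k' <= 6 -> pm k = pm k' -> k = k'.
  move=> k_lt k'_lt /setP/(_ (k%:R)%R); rewrite !inE eqxx /= => /esym/orP[].
    by rewrite natr_Zp_eq // !modn_small => [/eqP| |]; lia.
  by rewrite -addr_eq0 -natrD (negPf (nz _ _)); lia.
have stepA i : step (sets m w i) = pm (width m i).
  by rewrite stepE // nz //; have := width_bounds m i; lia.
rewrite /step_count.
have -> : [set step (sets m w i) | i : 'I_m] = [set pm 2; pm 5; pm 6].
  apply/setP => S; rewrite !inE; apply/imsetP/idP => [[i _ ->]|].
    by rewrite stepA /width; do 2?[case: ifP => _]; rewrite eqxx ?orbT.
  have lt0 : 0 < m by lia.
  have ltm : m.-1 < m by lia.
  case/orP=> [/orP[]|] /eqP ->;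
    [exists (Ordinal lt0)|exists (Ordinal m_gt1)|exists (Ordinal ltm)] => //;
    by rewrite stepA /width /= ?eqxx // ifN //; lia.
rewrite setUC cardsU1 cards2 !inE negb_or.
have neq k k' : 2 <= k <= 6 -> 2 <= k' <= 6 -> k != k' -> pm k != pm k'.
  by move=> lk lk'; apply: contra_neq; apply: pm_inj.
by rewrite !neq.
Qed.

(** * The construction *)

(** Base points for the same steps when the formulas of [corner] below
    degenerate: for h <= 1 the exchanged edges are not distinct, and for h = 2 the
    sets {25, 27} and {27, 4} would meet. *)
Definition small_corner h :=
  nth 0 (nth [::]
    [:: [:: 0; 5; 11]; [:: 0; 3; 13; 5; 19]; [:: 0; 3; 13; 7; 21; 9; 27]] h).

Lemma small_corner_inj h : h < 3 -> pts_inj (2 * h + 3) (small_corner h).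
Proof.
move=> h_lt i j p q i_lt j_lt p_i q_j /eqP pq.
have : all (fun h => let m := 2 * h + 3 in let P := pts m (small_corner h) in
  all (fun i => all (fun j => all (fun p => all (fun q =>
    (p == q %[mod 4 * m + 1]) ==> (i == j) && (p == q)) (P j)) (P i))
    (iota 0 m)) (iota 0 m)) (iota 0 3).
  by vm_compute.
move=> /allP/(_ h); rewrite mem_iota => /(_ h_lt).
move=> /allP/(_ i); rewrite mem_iota => /(_ i_lt).
move=> /allP/(_ j); rewrite mem_iota => /(_ j_lt).
move=> /allP/(_ p p_i) /allP/(_ q q_j).
by rewrite pq => /andP[/eqP -> /eqP ->].
Qed.

Lemma small_corner_cover h r : h < 3 -> 0 < r -> r < 4 * (2 * h + 3) + 1 ->
  is_diff (2 * h + 3) (small_corner h) r.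
Proof.
move=> h_lt r_gt0 r_lt.
have : all (fun h => let m := 2 * h + 3 in let P := pts m (small_corner h) in
  all (fun r => has (fun n => has (fun a => has (fun b =>
    a == b + r %[mod 4 * m + 1]) (P n)) (P (n.+1 %% m))) (iota 0 m))
    (iota 1 (4 * m))) (iota 0 3).
  by vm_compute.
move=> /allP/(_ h); rewrite mem_iota => /(_ h_lt).
have r_in : r \in iota 1 (4 * (2 * h + 3)) by rewrite mem_iota; lia.
move=> /allP/(_ r r_in).
case/hasP=> n; rewrite mem_iota => n_lt /hasP[a a_n /hasP[b b_n /eqP ab]].
by exists n, a, b.
Qed.

(** The base points of the rearranged zigzag, reduced modulo v.  The formulas for
    n < h and those for n > h + 1 are the parts before and after the tile at
    4h + 3, which joins the sets h and h + 1; they differ by the change of phase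
    in the middle.  The parity of h decides which of the sets h and h + 1 has
    step 5. *)
Definition corner h n :=
  if n == 0 then 0
  else if n < h then (if odd n then 4 * h + 9 + 2 * n else 4 * h + 8 - 2 * n)
  else if n == h then (if odd h then 2 * h + 4 else 6 * h + 13)
  else if n == h.+1 then (if odd h then 6 * h + 12 else 2 * h + 5)
  else if n <= 2 * h then (if odd n then 4 * h + 11 + 2 * n else 4 * h + 6 - 2 * n)
  else if n == 2 * h + 1 then 4 * h + 5 else 8 * h + 11.

Lemma corner0 h : corner h 0 = 0. Proof. by []. Qed.

Lemma corner_lo h n : 0 < n -> n < h ->
  corner h n = if odd n then 4 * h + 9 + 2 * n else 4 * h + 8 - 2 * n.
Proof.
move=> n_gt0 n_lt.
by rewrite /corner (ifN (b := n == 0)) ?(ifT (b := n < h)) //; lia.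
Qed.

Lemma corner_mid h : 0 < h -> corner h h = if odd h then 2 * h + 4 else 6 * h + 13.
Proof. by move=> h_gt0; rewrite /corner ltnn eqxx ifN //; lia. Qed.

Lemma corner_midS h : corner h h.+1 = if odd h then 6 * h + 12 else 2 * h + 5.
Proof. by rewrite /corner /= ifN ?(ifN (b := h.+1 == h)) ?eqxx; lia. Qed.

Lemma corner_hi h n : h.+1 < n -> n <= 2 * h ->
  corner h n = if odd n then 4 * h + 11 + 2 * n else 4 * h + 6 - 2 * n.
Proof.
move=> n_gt n_le; rewrite /corner (ifN (b := n == 0)) ?(ifN (b := n < h)).
rewrite (ifN (b := n == h)) ?(ifN (b := n == h.+1)) ?(ifT (b := n <= 2 * h)) //.
all: lia.
Qed.

Lemma corner_penultimate h : 0 < h -> corner h (2 * h).+1 = 4 * h + 5.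
Proof.
move=> h_gt0; rewrite /corner -addn1 (ifN (b := _ == 0)) ?(ifN (b := _ < h)).
rewrite (ifN (b := _ == h)) ?(ifN (b := _ == h.+1)) ?(ifN (b := _ <= 2 * h)) //.
1: by rewrite eqxx.
all: lia.
Qed.

Lemma corner_last h : corner h (2 * h + 2) = 8 * h + 11.
Proof. by rewrite /corner !ifN; lia. Qed.

Lemma modn_eq_cases v p q : p < 2 * v -> q < 2 * v -> p = q %[mod v] ->
  p = q \/ p = q + v \/ q = p + v.
Proof.
move=> lp lq.
have e x : x < 2 * v -> x %% v = x \/ x = x %% v + v.
  move=> lx; case: (ltnP x v) => xv; first by left; rewrite modn_small.
  right; rewrite -{2}(subnK xv) modnDr modn_small; lia.
case: (e p lp); case: (e q lq); lia.
Qed.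

(** The definition of [corner] in the linear form that decides all equalities
    between points by linear arithmetic. *)
Lemma corner_ptsP h n p : 2 < h -> n < 2 * h + 3 ->
    p \in pts (2 * h + 3) (corner h) n ->
  exists k e, e < 2 /\
  ((n = 0 /\ p = 2 * e) \/
   (n = 2 * k + 1 /\ n < h /\ p = 4 * h + 11 + 4 * k + 5 * e) \/
   (n = 2 * k + 2 /\ n < h /\ p + 4 * k = 4 * h + 4 + 2 * e) \/
   (n = h /\ h = 2 * k + 1 /\ p = 2 * h + 4 + 5 * e) \/
   (n = h /\ h = 2 * k /\ p = 6 * h + 13 + 2 * e) \/
   (n = h + 1 /\ h = 2 * k + 1 /\ p = 6 * h + 12 + 2 * e) \/
   (n = h + 1 /\ h = 2 * k /\ p = 2 * h + 5 + 5 * e) \/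
   (n = 2 * k + 1 /\ h + 1 < n < 2 * h /\ p = 4 * h + 13 + 4 * k + 5 * e) \/
   (n = 2 * k /\ h + 1 < n <= 2 * h /\ p + 4 * k = 4 * h + 6 + 2 * e) \/
   (n = 2 * h + 1 /\ p = 4 * h + 5 + 5 * e) \/
   (n = 2 * h + 2 /\ p = 8 * h + 11 + 6 * e)).
Proof.
rewrite /pts !inE => h_gt2 n_lt pn.
have [e e_lt2 {pn}->] : exists2 e, e < 2 & p = corner h n + width (2 * h + 3) n * e.
  by case/orP: pn => /eqP ->; [exists 0 | exists 1]; lia.
have oddE b : b = if odd b then 2 * b./2 + 1 else 2 * b./2.
  by have := odd_double_half b; case: odd; lia.
rewrite /corner /width.
have [->|n_neq0] := eqVneq n 0.
  by exists 0, e; split=> //; left; rewrite ifN /=; lia.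
have [n_lt_h|n_ge_h] := ltnP n h.
  rewrite (ifN (b := n == _)); last by lia.
  have := oddE n; case: ifP => _ nE.
    by exists n./2, e; split=> //; do 1!right; left; lia.
  by exists n./2.-1, e; split=> //; do 2!right; left; lia.
have [n_h|n_neq_h] := eqVneq n h.
  rewrite n_h (ifN (b := h == _)); last by lia.
  have := oddE h; case: ifP => _ hE.
    by exists h./2, e; split=> //; do 3!right; left; lia.
  by exists h./2, e; split=> //; do 4!right; left; lia.
have [n_h1|n_neq_h1] := eqVneq n h.+1.
  rewrite n_h1 (ifN (b := h.+1 == _)) /=; last by lia.
  have := oddE h; case: ifP => _ hE /=.
    by exists h./2, e; split=> //; do 5!right; left; lia.
  by exists h./2, e; split=> //; do 6!right; left; lia.
have [n_le|n_gt] := leqP n (2 * h).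
  rewrite (ifN (b := n == _)); last by lia.
  have := oddE n; case: ifP => _ nE.
    by exists n./2, e; split=> //; do 7!right; left; lia.
  by exists n./2, e; split=> //; do 8!right; left; lia.
have [->|n_neq] := eqVneq n (2 * h + 1).
  rewrite ifN; last by lia.
  by rewrite ifT; [exists 0, e; split=> //; do 9!right; left|]; lia.
by rewrite ifT; [exists 0, e; split=> //; do 10!right|]; lia.
Qed.

Lemma corner_inj h : 2 < h -> pts_inj (2 * h + 3) (corner h).
Proof.
move=> h_gt2 i j p q li lj /(corner_ptsP _ _ _ h_gt2 li)[k [e [e2 P]]].
move=> /(corner_ptsP _ _ _ h_gt2 lj)[k' [e' [e2' Q]]] /modn_eq_cases E.
have {}E : p = q \/ p = q + (8 * h + 13) \/ q = p + (8 * h + 13).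
  by rewrite (_ : 8 * h + 13 = 4 * (2 * h + 3) + 1); [apply: E|]; lia.
clear li lj.
by repeat case: P => P; repeat case: Q => Q; lia.
Qed.

(** * Differences of the construction *)

Local Notation corner_diff h := (is_diff (2 * h + 3) (corner h)).

Lemma modulusE h : 4 * (2 * h + 3) + 1 = 8 * h + 13.
Proof. by lia. Qed.

Definition tile s := [:: s; s + 2; s + 5; s + 7].

(** Two consecutive sets {x, x + 2} and {y, y + 5} have the differences
    y - x + {-2, 0, 3, 5}, and those from {x, x + 5} to {y, y + 2} are
    y - x + {-5, -3, 0, 2}: a tile in both cases, whose start tells y - x.  The
    multiple j of the modulus is the number of turns around the circle. *)
Lemma tile_edge h s n j : n < 2 * h + 1 ->
  corner h n.+1 + j * (8 * h + 13) = corner h n + s + (if odd n then 5 else 2) ->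
  {in tile s, forall r, corner_diff h r}.
Proof.
move=> n_lt edge r rs; have n_lt2 : n.+1 < 2 * h + 3 by lia.
suff [e [e' [e2 e2' E]]] : exists e e', [/\ e < 2, e' < 2 &
    corner h n.+1 + width (2 * h + 3) n.+1 * e + j * (8 * h + 13) =
    corner h n + width (2 * h + 3) n * e' + r].
  exists n, (corner h n.+1 + width (2 * h + 3) n.+1 * e).
  exists (corner h n + width (2 * h + 3) n * e'); split; first by lia.
  - by rewrite modn_small // !inE; case: e e2 E => [|[|]] //; lia.
  - by rewrite !inE; case: e' e2' E => [|[|]] //; lia.
  - by rewrite modulusE -E [in RHS]addnC modnMDl.
rewrite /width (ifN (b := n == _)) ?(ifN (b := n.+1 == _)); try lia.
move: rs edge; rewrite /= !inE.
case: odd => /= /or4P[] /eqP -> edge.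
- by exists 0, 1; split; lia.
- by exists 1, 1; split; lia.
- by exists 0, 0; split; lia.
- by exists 1, 0; split; lia.
- by exists 0, 1; split; lia.
- by exists 0, 0; split; lia.
- by exists 1, 1; split; lia.
- by exists 1, 0; split; lia.
Qed.

(** The edge that carries the tile at 4k + 1.  In the plain zigzag even k go to
    the part before the middle and odd k to the part after it; k = 0, 2h + 1,
    h + 2 and h - 1 are on the four exchanged edges. *)
Lemma bulk_tile h k : 2 < h -> k < 2 * h + 2 -> k != h -> k != h.+1 ->
  {in tile (4 * k + 1), forall r, corner_diff h r}.
Proof.
move=> h_gt2 k_lt kh kh1.
have [->|k_neq0] := eqVneq k 0.
  case: (boolP (odd h)) => h_odd.
    apply: (@tile_edge _ _ h.+1 0); first by lia.
    by rewrite corner_midS corner_hi; [do ![case: ifP => ?]; lia|lia..].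
  apply: (@tile_edge _ _ h.-1 0); first by lia.
  rewrite prednK; last by lia.
  by rewrite corner_mid ?corner_lo; [do ![case: ifP => ?]; lia|lia..].
have [->|k_neq_last] := eqVneq k (2 * h + 1).
  case: (boolP (odd h)) => h_odd.
    apply: (@tile_edge _ _ h.-1 1); first by lia.
    rewrite prednK; last by lia.
    by rewrite corner_mid ?corner_lo; [do ![case: ifP => ?]; lia|lia..].
  apply: (@tile_edge _ _ h.+1 1); first by lia.
  by rewrite corner_midS corner_hi; [do ![case: ifP => ?]; lia|lia..].
have [->|k_neq_h2] := eqVneq k h.+2.
  by apply: (@tile_edge _ _ 0 0); [lia|rewrite corner_lo ?corner0 /=; lia].
have [->|k_neq_h1] := eqVneq k h.-1.
  apply: (@tile_edge _ _ (2 * h) 0); first by lia.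
  by rewrite corner_penultimate ?corner_hi; [do ![case: ifP => ?]; lia|lia..].
have [k_odd|k_even] := boolP (odd k); have [k_lo|k_hi] := ltnP k h.
- apply: (@tile_edge _ _ (2 * h - k) 1); first by lia.
  by rewrite !corner_hi; [do ![case: ifP => ?]; lia|lia..].
- apply: (@tile_edge _ _ k.-1 0); first by lia.
  by rewrite !corner_hi; [do ![case: ifP => ?]; lia|lia..].
- apply: (@tile_edge _ _ k 0); first by lia.
  by rewrite !corner_lo; [do ![case: ifP => ?]; lia|lia..].
- apply: (@tile_edge _ _ (2 * h + 1 - k) 1); first by lia.
  by rewrite !corner_lo; [do ![case: ifP => ?]; lia|lia..].
Qed.

Lemma middle_tile h : 2 < h ->
  {in tile (4 * h + 3), forall r, corner_diff h r}.
Proof.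
move=> h_gt2; apply: (@tile_edge _ _ h (~~ odd h)); first by lia.
by rewrite corner_midS corner_mid; [do ![case: ifP => ?]; lia|lia..].
Qed.

(** The pieces (4h + 1) + {0, 5, 6, 11} and {-4, -2, 2, 4} of the last set. *)
Lemma edge_to_last h : 2 < h ->
  {in [:: 4 * h + 1; 4 * h + 6; 4 * h + 7; 4 * h + 12],
     forall r, corner_diff h r}.
Proof.
move=> h_gt2 r r_in; exists (2 * h).+1; rewrite /pts modn_small; last by lia.
rewrite corner_penultimate; last by lia.
rewrite (_ : width (2 * h + 3) (2 * h).+1 = 5); last first.
  by rewrite /width ifN ?ifT; lia.
have -> : (2 * h).+2 = 2 * h + 2 by lia.
rewrite corner_last (_ : width (2 * h + 3) (2 * h + 2) = 6); last first.
  by rewrite /width ifT; lia.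
move: r_in; rewrite !inE => /or4P[] /eqP ->;
  [exists (8 * h + 11), (4 * h + 10)|exists (8 * h + 11), (4 * h + 5)
  |exists (8 * h + 17), (4 * h + 10)|exists (8 * h + 17), (4 * h + 5)].
all: by split; rewrite ?inE; [lia..|congr (_ %% _); lia].
Qed.

Lemma edge_from_last h : 2 < h ->
  {in [:: 2; 4; 8 * h + 9; 8 * h + 11], forall r, corner_diff h r}.
Proof.
move=> h_gt2 r r_in; exists (2 * h + 2); rewrite /pts corner_last.
rewrite (_ : width (2 * h + 3) (2 * h + 2) = 6); last by rewrite /width ifT; lia.
rewrite (_ : (2 * h + 2).+1 = 2 * h + 3) ?modnn; last by lia.
rewrite corner0 (_ : width (2 * h + 3) 0 = 2); last by rewrite /width ifN //; lia.
have turns j a b : a + j * (8 * h + 13) = b -> a = b %[mod 8 * h + 13].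
  by move=> <-; rewrite [a + _]addnC modnMDl.
rewrite modulusE; move: r_in; rewrite !inE => /or4P[] /eqP ->.
- by exists 0, (8 * h + 11); split; rewrite ?inE; [lia..|apply: (turns 1); lia].
- by exists 2, (8 * h + 11); split; rewrite ?inE; [lia..|apply: (turns 1); lia].
- by exists 0, (8 * h + 17); split; rewrite ?inE; [lia..|apply: (turns 2); lia].
- by exists 2, (8 * h + 17); split; rewrite ?inE; [lia..|apply: (turns 2); lia].
Qed.

(** The elements of the tile at 4k + 1 are 1 and 3 modulo 4 in the block of four
    residues above 4k, and 2 and 4 in the next block; so the residue modulo 4 of
    r tells the tile that contains it, up to the pieces of the last set and the
    tile at 4h + 3. *)
Lemma corner_cover h r : 2 < h -> 0 < r -> r < 4 * (2 * h + 3) + 1 ->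
  corner_diff h r.
Proof.
move=> h_gt2 r_gt0 r_lt.
have inB k : k < 2 * h + 2 -> k != h -> k != h.+1 ->
    r \in tile (4 * k + 1) -> corner_diff h r.
  by move=> k_lt kh kh1; apply: bulk_tile.
have inM := middle_tile h h_gt2 r.
have inP := edge_to_last h h_gt2 r.
have inQ := edge_from_last h h_gt2 r.
pose k := r.-1 %/ 4.
have [r1|r3|r2|r4] :
    [\/ r = 4 * k + 1, r = 4 * k + 3, r = 4 * k + 2 | r = 4 * k + 4].
  have := divn_eq r.-1 4; rewrite -/k.
  case: (r.-1 %% 4) (ltn_pmod r.-1 (isT : 0 < 4)) => [|[|[|[|]]]] // _ rE.
  - by constructor 1; lia.
  - by constructor 3; lia.
  - by constructor 2; lia.
  - by constructor 4; lia.
all: move: inP inQ inM; rewrite /= !inE => inP inQ inM.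
- have [kh|kh] := eqVneq k h; first by apply: inP; lia.
  have [kh1|kh1] := eqVneq k h.+1; first by apply: inM; lia.
  have [kl|kl] := eqVneq k (2 * h + 2); first by apply: inQ; lia.
  by apply: (inB k); rewrite ?inE; lia.
- have [kh|kh] := eqVneq k h; first by apply: inM; lia.
  have [kh1|kh1] := eqVneq k h.+1; first by apply: inP; lia.
  have [kl|kl] := eqVneq k (2 * h + 2); first by apply: inQ; lia.
  by apply: (inB k); rewrite ?inE; lia.
- have [kh|kh] := eqVneq k h.+1; first by apply: inP; lia.
  have [kh1|kh1] := eqVneq k h.+2; first by apply: inM; lia.
  have [kl|kl] := eqVneq k 0; first by apply: inQ; lia.
  by apply: (inB k.-1); rewrite ?inE; lia.
- have [kh|kh] := eqVneq k h.+1; first by apply: inM; lia.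
  have [kh1|kh1] := eqVneq k h.+2; first by apply: inP; lia.
  have [kl|kl] := eqVneq k 0; first by apply: inQ; lia.
  by apply: (inB k.-1); rewrite ?inE; lia.
Qed.

Theorem theorem5p1 (m : nat) (m_odd : odd m) (m_gt1 : 1 < m) :
  exists A : 'I_m -> {set 'Z_(4 * m + 1)},
    is_CEDF (4 * m + 1) 2 1 A /\ step_count A = 3.
Proof.
have [h mE] : exists h, m = 2 * h + 3.
  by exists (m - 3)./2; have := odd_double_half m; rewrite m_odd; lia.
have [w [w_inj w_cover]] : exists w, pts_inj m w /\
    forall r, 0 < r -> r < 4 * m + 1 -> is_diff m w r.
  rewrite mE; have [h_small|h_large] := ltnP h 3.
    exists (small_corner h); split=> [|r]; first exact: small_corner_inj.
    exact: small_corner_cover.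
  by exists (corner h); split=> [|r]; [exact: corner_inj|exact: corner_cover].
exists (sets m w); split; first exact: CEDF_of_pts.
exact: step_count_sets.
Qed.
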